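(* Let $(T,d)$ be a finite metric tree with $n=|T|\ge 3$ vertices. Then there exists $\zeta>0$ such that $(T,d)$ has strict $p$-negative type for all $p\in(1-\zeta,1+\zeta)$. Moreover, $\zeta$ may be chosen so that it depends only upon the unordered distribution of the tree's edge weights (that is, one and the same $\zeta$ can be used for all finite metric trees having the same multiset of edge weights).
   Context: A finite metric tree $(T,d)$ is a finite connected graph $T$ without cycles (identified with its vertex set), each edge carrying a positive weight, where $d(x,y)$ is the sum of the weights of the edges on the unique path from $x$ to $y$. For $p\ge 0$, a metric space $(X,d)$ has $p$-negative type if for all $n\ge2$, all finite subsets $\{x_1,\dots,x_n\}\subseteq X$ (distinct points), and all real $\eta_1,\dots,\eta_n$ with $\eta_1+\cdots+\eta_n=0$, one has $\sum_{1\le i,j\le n}d(x_i,x_j)^p\eta_i\eta_j\le 0$. It has strict $p$-negative type if moreover this inequality is strict whenever $(\eta_1,\dots,\eta_n)\ne(0,\dots,0)$. *)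

(* Defs.v *)
From HB Require Import structures.
From mathcomp Require Import all_boot all_order all_algebra.
From mathcomp Require Import reals exp.

Set Implicit Arguments.
Unset Strict Implicit.
Unset Printing Implicit Defensive.

Import Order.TTheory GRing.Theory Num.Theory.
Local Open Scope ring_scope.

Section NegativeType.
Context {R : realType} {X : Type}.
Implicit Types (d : X -> X -> R) (p : R).

Definition negative_type_sum d p n (x : 'I_n -> X) (eta : 'I_n -> R) : R :=
  \sum_(i < n) \sum_(j < n) (d (x i) (x j) `^ p) * eta i * eta j.

(* The notion only makes sense for 0 <= p, so this is part of the predicate. *)
Definition negative_type d p : Prop :=
  0 <= p /\
  forall (n : nat) (x : 'I_n -> X) (eta : 'I_n -> R),
    (2 <= n)%N -> injective x -> \sum_(i < n) eta i = 0 ->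
    negative_type_sum d p x eta <= 0.

Definition strict_negative_type d p : Prop :=
  negative_type d p /\
  forall (n : nat) (x : 'I_n -> X) (eta : 'I_n -> R),
    (2 <= n)%N -> injective x -> \sum_(i < n) eta i = 0 ->
    (exists i, eta i != 0) ->
    negative_type_sum d p x eta < 0.

End NegativeType.

(* Only the values of [weight] on the pairs [set x; y] with [edge x y] matter.
   In a simple graph a cycle is a duplicate-free closed walk with at least
   three vertices; [ucycle] alone also accepts x, y, x. *)
Record metric_tree (R : realType) := MetricTree {
  vertex :> finType;
  edge : rel vertex;
  weight : {set vertex} -> R;
  edge_sym : symmetric edge;
  edge_irr : irreflexive edge;
  edge_connected : forall x y, connect edge x y;
  edge_acyclic : forall c : seq vertex, (3 <= size c)%N -> ~ ucycle edge c;
  weight_gt0 : forall x y, edge x y -> 0 < weight [set x; y]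
}.

Section MetricTree.
Context {R : realType} (T : metric_tree R).

Definition edges : {set {set T}} :=
  [set [set x; y] | x in [set: T], y in [set: T] & edge x y].

(* A list representing the multiset of edge weights: compare with perm_eq. *)
Definition edge_weights : seq R := [seq weight A | A <- enum edges].

Definition simple_path (x y : T) (s : seq T) : bool :=
  [&& path (@edge R T) x s, uniq (x :: s) & last x s == y].

Lemma simple_path_ex (x y : T) : exists s, simple_path x y s.
Proof.
have /connectP[s es ->] := edge_connected x y.
by case: (shortenP es) => s' es' us' _; exists s'; apply/and3P.
Qed.

(* By edge_acyclic this is the only simple path from x to y. *)
Definition tree_path (x y : T) : seq T := xchoose (simple_path_ex x y).

Definition path_weight (x : T) (s : seq T) : R :=
  \sum_(a <- zip (x :: s) s) weight [set a.1; a.2].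

Definition tree_dist (x y : T) : R := path_weight x (tree_path x y).

End MetricTree.

(* Main.v *)
Require Import Defs.
From HB Require Import structures.
From mathcomp Require Import all_boot all_order all_algebra.
From mathcomp Require Import reals exp.
From mathcomp Require Import sequences.
From mathcomp Require Import ring lra.

(** Write [d] for the tree distance and let [eta] have sum zero.  Removing an
    edge [A] of a tree leaves two components, and a simple path from [x] to [y]
    uses [A], exactly once, if and only if [x] and [y] lie in different ones
    ([mem_tree_path_edges]).  Hence [d] is a positive combination of cut
    metrics, [d x y = \sum_A weight A * [A separates x and y]]
    ([tree_distE]), and a cut contributes
    [- 2 a_A ^ 2] to the quadratic form of [d], where [a_A] is the sum of [eta]
    over one component ([cut_form]).  This is the classical reason for
    1-negative type.

    Strictness with a constant that sees only the weights comes from the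
    converse reconstruction of [eta] from the [a_A]: the simple path from [v]
    to any other vertex uses exactly one of the edges at [v], so [- eta v] is
    a signed sum of the [a_A] over the edges [A] at [v].  An edge has two ends,
    so the l1 norm of [eta] is at most [2 * \sum_A `|a_A|] ([mass_le]), and
    Cauchy-Schwarz bounds the form of [d] above by minus the squared l1 norm
    divided by [2 K] ([tree_form_le]), where [K] is any bound on the sum of the
    inverse weights.

    Finally, all positive distances lie between [1 / K] and [K] for
    [K = 1 + \sum_w (w + 1 / w)], an interval on which [t `^ p] is
    uniformly close to [t] for [p] near [1] ([powR_near1]).  If the difference
    is at most [1 / (4 K)], the form of [d `^ p] differs from that of [d] by at
    most half of the gap just obtained. *)

Set Implicit Arguments.
Unset Strict Implicit.
Unset Printing Implicit Defensive.

Import Order.TTheory GRing.Theory Num.Theory.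
Local Open Scope ring_scope.

(** * Edges of paths *)

Section PathEdges.
Variable T : finType.
Implicit Types (x y : T) (s : seq T) (A : {set T}) (e : rel T).

Definition path_edges x s : seq {set T} :=
  [seq [set a.1; a.2] | a <- zip (x :: s) s].

Lemma path_edges_cons x y s :
  path_edges x (y :: s) = [set x; y] :: path_edges y s.
Proof. by []. Qed.

Lemma path_edges_mem x s A z : A \in path_edges x s -> z \in A -> z \in x :: s.
Proof.
elim: s x => [|y s IH] x; first by rewrite in_nil.
rewrite path_edges_cons inE => /orP[/eqP-> | As zA].
  by rewrite !inE => /orP[] ->; rewrite ?orbT.
by rewrite inE (IH _ As zA) orbT.
Qed.

Lemma path_edges_uniq x s : uniq (x :: s) -> uniq (path_edges x s).
Proof.
elim: s x => [|y s IH] x //; rewrite path_edges_cons => /andP[xs us].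
rewrite cons_uniq IH // andbT; apply: contra xs => As.
by apply: (path_edges_mem As); rewrite !inE eqxx.
Qed.

Definition del_edge e A : rel T := fun x y => e x y && ([set x; y] != A).

Lemma path_del_edge e A x s :
  path e x s -> A \notin path_edges x s -> path (del_edge e A) x s.
Proof.
elim: s x => [|y s IH] x //=; rewrite path_edges_cons inE negb_or.
by move=> /andP[exy ps] /andP[nA As]; rewrite IH // andbT /del_edge exy eq_sym.
Qed.

(** A repetition-free path meets an edge once, so the pieces before and after
    that edge survive its deletion. *)
Lemma path_split_edge e A x s :
    path e x s -> uniq (x :: s) -> A \in path_edges x s ->
  exists a b, [/\ e a b, A = [set a; b], connect (del_edge e A) x a
                & connect (del_edge e A) b (last x s)].
Proof.
elim: s x => [|y s IH] x //; rewrite path_edges_cons inE.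
move=> /= /andP[exy ps] /andP[xs us].
case: (eqVneq A [set x; y]) => [defA _ | nA /= As].
  exists x, y; split=> //; apply/connectP; exists s => //.
  apply: path_del_edge => //; apply: contra xs => As.
  by apply: (path_edges_mem As); rewrite defA !inE eqxx.
have [a [b [eab defA ya bl]]] := IH _ ps us As.
exists a, b; split=> //; apply: connect_trans ya; apply: connect1.
by rewrite /del_edge exy eq_sym.
Qed.

End PathEdges.

(** * Tree distances as sums of cuts *)

Section Cuts.
Context {R : realType} (T : metric_tree R).
Implicit Types (x y z u v : T) (A : {set T}).

Definition separates A x y : bool :=
  ~~ connect (del_edge (@edge R T) A) x y.

Lemma del_edge_connect_sym A : connect_sym (del_edge (@edge R T) A).
Proof. by apply: sym_connect_sym => x y; rewrite /del_edge edge_sym setUC. Qed.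

(** A connection that avoids the edge would close up with it to a cycle. *)
Lemma edge_bridge u v : edge u v -> separates [set u; v] u v.
Proof.
move=> euv; apply/negP => /connectP[s ps lv].
case: (shortenP ps) lv => {ps} s' ps us _ lv.
have sub_e : subrel (del_edge (@edge R T) [set u; v]) (@edge R T).
  by move=> x y; rewrite /del_edge => /andP[].
apply: (@edge_acyclic R T (u :: s')).
  case: s' ps lv us => [|a [|b s']] //=.
    by move=> _ vu; rewrite vu edge_irr in euv.
  by move=> + av; rewrite -av /del_edge eqxx andbF.
rewrite /ucycle us andbT /= rcons_path (sub_path sub_e ps) -lv /=.
by rewrite edge_sym.
Qed.

(** Walk along a path from [u]: the component can only change at the deleted
    edge, whose ends are [u] and [v] themselves. *)
Lemma del_edge_sides u v x :
  ~~ separates [set u; v] u x || ~~ separates [set u; v] v x.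
Proof.
rewrite !negbK; set c := connect _.
have walk p s : path (@edge R T) p s -> c u p || c v p ->
    c u (last p s) || c v (last p s).
  elim: s p => [|q s IH] p //= /andP[epq ps] cp; apply: (IH _ ps).
  case: (eqVneq [set p; q] [set u; v]) => [defA | nA].
    have: q \in [set u; v] by rewrite -defA !inE eqxx orbT.
    by rewrite !inE => /orP[] /eqP ->; rewrite /c connect0 ?orbT.
  have cpq : c p q.
    by apply: connect1; rewrite /del_edge epq.
  by apply/orP; case/orP: cp => cp; [left | right]; apply: connect_trans cpq.
have /connectP[s es ->] := @edge_connected R T u x.
by apply: walk es _; rewrite /c connect0.
Qed.

Lemma edgesP A : A \in edges T -> exists u v, edge u v /\ A = [set u; v].
Proof. by case/imset2P=> u v _; rewrite inE => /andP[_ euv] ->; exists u, v. Qed.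

Lemma mem_edges u v : edge u v -> [set u; v] \in edges T.
Proof. by move=> euv; apply/imset2P; exists u v; rewrite ?inE. Qed.

(** There are only two components, so the cut is the boundary of one of them,
    whatever vertex [z] is used to name it. *)
Lemma separates_cut z A x y :
  A \in edges T -> separates A x y = separates A z x (+) separates A z y.
Proof.
case/edgesP=> u [v [euv ->]]; move: (edge_bridge euv).
rewrite /separates; set c := connect _ => nuv.
have csym : connect_sym (del_edge (@edge R T) [set u; v]).
  exact: del_edge_connect_sym.
(* The two components are exhaustive and exclude each other, so [c u] alone
   decides connection after deletion. *)
have cv a : c v a = ~~ c u a.
  have := del_edge_sides u v a; rewrite /separates !negbK -/c.
  case: (boolP (c u a)) => //= ua _; apply: contraNF nuv => va.
  by apply: (connect_trans ua); rewrite csym.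
have csame a b : c a b -> c a =1 c b by apply: same_connect.
have cE a b : c a b = (c u a == c u b).
  case: (boolP (c u a)) => ua; first by rewrite -(csame _ _ ua).
  have va : c v a by rewrite cv.
  by rewrite -(csame _ _ va) cv.
by rewrite !(cE x) !(cE z); do 3!case: (c u _).
Qed.

Lemma tree_path_simple x y : simple_path x y (tree_path x y).
Proof. exact: (xchooseP (simple_path_ex x y)). Qed.

Lemma mem_tree_path_edges A x y :
  (A \in path_edges x (tree_path x y)) = separates A x y.
Proof.
have /and3P[ps us /eqP ls] := tree_path_simple x y.
apply/idP/idP => [As|]; last first.
  apply: contraR => nA; apply/connectP; exists (tree_path x y) => //.
  exact: path_del_edge.
have [a [b [eab defA xa bl]]] := path_split_edge ps us As.
rewrite ls in bl; subst A; apply: contraL (edge_bridge eab) => xy.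
rewrite negbK del_edge_connect_sym; apply: connect_trans bl _.
rewrite del_edge_connect_sym; apply: connect_trans _ xy.
by rewrite del_edge_connect_sym.
Qed.

Lemma path_edges_sub A x s :
  path (@edge R T) x s -> A \in path_edges x s -> A \in edges T.
Proof.
elim: s x => [|y s IH] x //= /andP[exy ps].
by rewrite path_edges_cons inE => /orP[/eqP-> | /(IH _ ps)//]; apply: mem_edges.
Qed.

Lemma tree_distE x y :
  tree_dist x y = \sum_(A in edges T) weight A * (separates A x y)%:R.
Proof.
have /and3P[ps us _] := tree_path_simple x y.
rewrite /tree_dist /path_weight -(big_map _ xpredT) -/(path_edges _ _).
rewrite big_uniq ?path_edges_uniq //= [RHS]big_mkcond [LHS]big_mkcond /=.
apply: eq_bigr => A _; rewrite -mem_tree_path_edges.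
case: (boolP (A \in path_edges _ _)) => [As|_]; last by rewrite mulr0 if_same.
by rewrite (path_edges_sub ps As) mulr1.
Qed.

(** A simple path leaves its starting point by its first edge and never comes
    back. *)
Lemma sum_separates_star x y :
  \sum_(A in edges T | x \in A) (separates A x y)%:R = (x != y)%:R :> R.
Proof.
under eq_bigr do rewrite -mem_tree_path_edges.
have /and3P[ps us /eqP] := tree_path_simple x y.
case: (tree_path x y) ps us => [|z s] /=.
  by move=> _ _ ->; rewrite eqxx big1.
move=> /andP[exz ps] /andP[xs us] ls.
have -> : x != y by apply: contraNneq xs => ->; rewrite -ls mem_last.
rewrite (bigD1 [set x; z]) /=; last by rewrite mem_edges // !inE eqxx.
rewrite path_edges_cons inE eqxx big1 ?addr0 // => A /andP[/andP[_ xA] nA].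
rewrite inE (negPf nA) /=; case: (boolP (A \in _)) => // As.
by rewrite (path_edges_mem As xA) in xs.
Qed.

Lemma edge_weight_gt0 A : A \in edges T -> 0 < weight A.
Proof. by case/edgesP=> u [v [euv ->]]; apply: weight_gt0. Qed.

Lemma tree_dist_xx x : tree_dist x x = 0.
Proof.
by rewrite tree_distE big1 // => A _; rewrite /separates connect0 mulr0.
Qed.

(** Simplicity of the path matters: no edge is counted twice. *)
Lemma tree_dist_le x y : tree_dist x y <= \sum_(A in edges T) weight A.
Proof.
rewrite tree_distE ler_sum // => A /edge_weight_gt0/ltW w0.
by rewrite ler_piMr // lern1 leq_b1.
Qed.

Lemma tree_dist_ge x y : x != y ->
  exists2 A, A \in edges T & weight A <= tree_dist x y.
Proof.
move=> nxy; have := sum_separates_star x y; rewrite nxy => s1.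
have [A /andP[eA _] sA] : exists2 A, (A \in edges T) && (x \in A)
                                     & separates A x y.
  apply/exists_inP; apply: contra_eqT s1 => /exists_inPn h.
  by rewrite big1 ?(eq_sym 0) ?oner_neq0 // => A /h /negPf ->.
exists A => //; rewrite tree_distE (bigD1 A) //= sA mulr1 lerDl sumr_ge0 //.
by move=> B /andP[/edge_weight_gt0/ltW w0 _]; rewrite mulr_ge0.
Qed.

End Cuts.

(** * The quadratic form of a cut *)

Section CutForm.
Context {R : realType} {I : finType} (side : pred I) (eta : I -> R).
Hypothesis eta0 : \sum_i eta i = 0.

(** Zero total makes the two sides of a cut carry opposite masses, so a row of
    the cut matrix sees the same value up to the sign of its side. *)
Lemma cut_row i :
  \sum_j (side i (+) side j)%:R * eta j =
  (-1) ^+ side i * \sum_(j | side j) eta j.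
Proof.
case: (side i) => /=.
  apply/eqP; rewrite expr1 mulN1r -addr_eq0 -[eqbRHS]eta0.
  rewrite [X in _ + X]big_mkcond -big_split /=; apply/eqP/eq_bigr => j _.
  by case: (side j); rewrite ?mul0r ?mul1r ?addr0 ?add0r.
rewrite expr0 mul1r [RHS]big_mkcond; apply: eq_bigr => j _.
by case: (side j); rewrite ?mul0r ?mul1r.
Qed.

Lemma cut_form :
  \sum_i \sum_j (side i (+) side j)%:R * eta i * eta j =
  - 2 * (\sum_(j | side j) eta j) ^+ 2.
Proof.
under eq_bigr => i _.
  under eq_bigr => j _ do rewrite mulrAC mulrC.
  rewrite -mulr_sumr cut_row.
over.
set a := \sum_(j | side j) eta j.
have sgn : \sum_i eta i * (-1) ^+ side i = - 2 * a.
  rewrite -[RHS]add0r -[X in _ = X + _]eta0 /a.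
  rewrite [X in - 2 * X]big_mkcond mulr_sumr -big_split /=.
  by apply: eq_bigr => j _; case: (side j) => /=; ring.
under eq_bigr do rewrite mulrA.
by rewrite -mulr_suml sgn expr2 mulrA.
Qed.

End CutForm.

(** * The gap of the form of a tree distance *)

Section TreeForm.
Context {R : realType} (T : metric_tree R) {I : finType}.
Variables (x : I -> T) (eta : I -> R) (r : T).

Definition side (A : {set T}) : pred I := fun i => separates A r (x i).

(** Read [eta i] as a demand (a supply when negative) at the point [x i]; if
    the total is zero, this is the net amount that has to cross [A] towards the
    side away from [r]. *)
Definition flow (A : {set T}) : R := \sum_(i | side A i) eta i.

Hypotheses (x_inj : injective x) (eta0 : \sum_i eta i = 0).

Lemma tree_form :
  \sum_i \sum_j tree_dist (x i) (x j) * eta i * eta j =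
  - 2 * \sum_(A in edges T) weight A * flow A ^+ 2.
Proof.
under eq_bigr => i _.
  under eq_bigr => j _ do rewrite tree_distE !mulr_suml.
  rewrite exchange_big /=.
over.
rewrite exchange_big /= mulr_sumr; apply: eq_bigr => A eA.
rewrite mulrCA /flow -(cut_form (side A) eta0) mulr_sumr.
apply: eq_bigr => i _; rewrite mulr_sumr; apply: eq_bigr => j _.
by rewrite (separates_cut r) // !mulrA.
Qed.

(** Conservation at one vertex: what is demanded at [x i] arrives through the
    edges at [x i].  Formally, [- eta i] is the sum of [eta j] over [j != i],
    and the far sides of the edges at [x i] partition the other points. *)
Lemma mass_at_le i :
  `|eta i| <= \sum_(A in edges T | x i \in A) `|flow A|.
Proof.
have -> : eta i = - \sum_(A in edges T | x i \in A) (-1) ^+ side A i * flow A.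
  have -> : \sum_(A in edges T | x i \in A) (-1) ^+ side A i * flow A =
            \sum_j (i != j)%:R * eta j.
    under [RHS]eq_bigr => j _.
      rewrite -(inj_eq x_inj) -sum_separates_star mulr_suml.
    over.
    rewrite exchange_big /=; apply: eq_bigr => A /andP[eA _].
    rewrite /flow -(cut_row (side A) eta0); apply: eq_bigr => j _.
    by rewrite (separates_cut r).
  apply/eqP; rewrite -addr_eq0 -[eqbRHS]eta0 (bigD1 i) //= eqxx mul0r add0r.
  rewrite [eqbRHS](bigD1 i) //=; apply/eqP; congr (_ + _).
  by apply: eq_bigr => j; rewrite eq_sym => ->; rewrite mul1r.
rewrite normrN; apply: le_trans (ler_norm_sum _ _ _) _.
by apply: ler_sum => A _; rewrite normrM normrX normrN1 expr1n mul1r.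
Qed.

(** Summing over [i] charges an edge at each of its ends, hence at most twice. *)
Lemma mass_le : \sum_i `|eta i| <= 2 * \sum_(A in edges T) `|flow A|.
Proof.
apply: le_trans (ler_sum _ (fun i _ => mass_at_le i)) _.
under eq_bigr do rewrite big_mkcondr.
rewrite exchange_big mulr_sumr ler_sum //= => A eA.
rewrite -big_mkcond sumr_const mulr_natl ler_wpMn2l //.
rewrite -(card_imset _ x_inj).
apply: (@leq_trans #|A|).
  by apply/subset_leq_card/subsetP => _ /imsetP[i iA ->].
by have [u [v [_ ->]]] := edgesP eA; rewrite cards2; case: (_ != _).
Qed.

End TreeForm.

(** Cauchy-Schwarz, obtained from the square of [`|a i| - t / w i] at
    [t = S / K] with [S] the sum on the left. *)
Lemma weighted_cauchy_schwarz (R : realFieldType) (I : finType) (P : pred I)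
    (w a : I -> R) (K : R) :
    0 < K -> (forall i, P i -> 0 < w i) -> \sum_(i | P i) (w i)^-1 <= K ->
  (\sum_(i | P i) `|a i|) ^+ 2 / K <= \sum_(i | P i) w i * a i ^+ 2.
Proof.
move=> K0 w0 wK; set S := \sum_(i | P i) `|a i|; pose t := S / K.
have: \sum_(i | P i) (2 * t * `|a i| - t ^+ 2 * (w i)^-1) <=
      \sum_(i | P i) w i * a i ^+ 2.
  apply: ler_sum => i /w0 wi; rewrite -(real_normK (num_real (a i))).
  rewrite -subr_ge0.
  have -> : w i * `|a i| ^+ 2 - (2 * t * `|a i| - t ^+ 2 / w i) =
            w i * (`|a i| - t / w i) ^+ 2 by field; rewrite gt_eqF.
  by rewrite mulr_ge0 ?sqr_ge0 // ltW.
apply: le_trans; rewrite sumrB -!mulr_sumr -/S.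
have : t ^+ 2 * \sum_(i | P i) (w i)^-1 <= t ^+ 2 * K.
  by rewrite ler_wpM2l ?sqr_ge0.
have -> : t ^+ 2 * K = S ^+ 2 / K by rewrite /t; field; rewrite gt_eqF.
have -> : 2 * t * S = 2 * (S ^+ 2 / K) by rewrite /t; field; rewrite gt_eqF.
lra.
Qed.

Lemma tree_form_le (R : realType) (T : metric_tree R) (I : finType)
    (x : I -> T) (eta : I -> R) (K : R) :
    injective x -> \sum_i eta i = 0 ->
    0 < K -> \sum_(A in edges T) (weight A)^-1 <= K ->
  \sum_i \sum_j tree_dist (x i) (x j) * eta i * eta j <=
  - ((\sum_i `|eta i|) ^+ 2 / (2 * K)).
Proof.
move=> x_inj eta0 K0 wK.
case: (pickP I) => [i0 _ | noI]; last first.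
  by rewrite !big_pred0 // expr0n mul0r oppr0.
rewrite (tree_form x (x i0)) //.
have := mass_le (x i0) x_inj eta0.
set M := \sum_i `|eta i| => hM.
have := weighted_cauchy_schwarz (flow x eta (x i0)) K0
  (@edge_weight_gt0 R T) wK.
set S := \sum_(A in _) `|_| in hM *; move=> hS.
rewrite mulNr lerN2.
apply: le_trans (_ : 2 * (S ^+ 2 / K) <= _); last by rewrite ler_wpM2l.
have -> : 2 * (S ^+ 2 / K) = (2 * S) ^+ 2 / (2 * K) by field; rewrite gt_eqF.
rewrite ler_wpM2r ?invr_ge0 ?mulr_ge0 ?(ltW K0) // lerXn2r ?nnegrE //.
  by rewrite sumr_ge0.
by rewrite mulr_ge0 ?sumr_ge0.
Qed.

(** * Powers with exponent near one *)

Lemma expR_sub1_le (R : realType) (t : R) :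
  `|t| <= 2^-1 -> `|expR t - 1| <= 2 * `|t|.
Proof.
move=> ht.
have h1 := expR_ge1Dx t; have h2 := expR_ge1Dx (- t).
have h3 := expR_gt0 t.
have h4 : expR t * (1 - t) <= 1.
  by rewrite -[leRHS](expRxMexpNx_1 t) ler_wpM2l // ltW.
rewrite ler_norml.
by case: (ger0P t) ht => t0 ht; apply/andP; split; nra.
Qed.

(** Write [t `^ p = t * expR ((p - 1) * ln t)]; both [t] and [1 / t] being at
    most [K], the logarithm is at most [K] in absolute value. *)
Lemma powR_near1 (R : realType) (K p t : R) :
    0 < t -> t <= K -> t^-1 <= K -> K * `|p - 1| <= 2^-1 ->
  `|t `^ p - t| <= 2 * K ^+ 2 * `|p - 1|.
Proof.
move=> t0 tK tVK hp; set h := p - 1 in hp *.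
have ln_le (u : R) : 0 < u -> ln u <= u.
  move=> u0; have : ln (1 + (u - 1)) <= u - 1 by apply: le_ln1Dx; lra.
  by rewrite addrC subrK; lra.
have lnt : `|ln t| <= K.
  rewrite ler_norml (le_trans (ln_le _ t0)) // andbT lerNl -lnV ?posrE //.
  by rewrite (le_trans (ln_le _ _)) ?invr_gt0.
have K0 : 0 < K by apply: lt_le_trans tK.
have -> : t `^ p - t = t * (expR (h * ln t) - 1).
  have tE : expR (ln t) = t by rewrite lnK ?posrE.
  rewrite /powR gt_eqF // mulrBr mulr1 -[X in _ = X * _ - _]tE -expRD /h.
  by congr (expR _ - _); ring.
have hl : `|h * ln t| <= `|h| * K by rewrite normrM ler_wpM2l.
rewrite normrM gtr0_norm //.
have -> : 2 * K ^+ 2 * `|h| = K * (2 * (`|h| * K)) by ring.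
apply: ler_pM => //; first exact: ltW.
apply: le_trans (expR_sub1_le _) _; last by rewrite ler_wpM2l.
by apply: le_trans hl _; rewrite mulrC.
Qed.

(** * Strict negative type *)

Section Perturbation.
Context {R : realType} (T : metric_tree R).

Lemma tree_dist_powR_near1 (K p : R) (x y : T) :
    \sum_(A in edges T) weight A <= K ->
    \sum_(A in edges T) (weight A)^-1 <= K ->
    0 < p -> K * `|p - 1| <= 2^-1 ->
  `|tree_dist x y `^ p - tree_dist x y| <= 2 * K ^+ 2 * `|p - 1|.
Proof.
move=> wK wVK p0 hp; case: (eqVneq x y) => [<- | nxy].
  rewrite tree_dist_xx powR0 ?gt_eqF // subr0 normr0.
  by rewrite mulr_ge0 // mulr_ge0 ?sqr_ge0.
have [A eA Ad] := tree_dist_ge nxy; have wA := edge_weight_gt0 eA.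
have d0 := lt_le_trans wA Ad.
apply: powR_near1 => //; first exact: le_trans (tree_dist_le x y) wK.
apply: le_trans wVK; rewrite (bigD1 A) //= ler_wpDr ?lef_pV2 ?posrE //.
by apply: sumr_ge0 => B /andP[/edge_weight_gt0/ltW wB _]; rewrite invr_ge0.
Qed.

(** The last hypothesis keeps the perturbation to half of the gap of
    [tree_form_le]. *)
Lemma tree_form_powR_lt0 (I : finType) (x : I -> T) (eta : I -> R) (K p : R) :
    injective x -> \sum_i eta i = 0 -> (exists i, eta i != 0) ->
    0 < K -> \sum_(A in edges T) weight A <= K ->
    \sum_(A in edges T) (weight A)^-1 <= K ->
    0 < p -> K * `|p - 1| <= 2^-1 -> 2 * K ^+ 2 * `|p - 1| <= (4 * K)^-1 ->
  \sum_i \sum_j (tree_dist (x i) (x j) `^ p) * eta i * eta j < 0.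
Proof.
move=> x_inj eta0 [i0 ni0] K0 wK wVK p0 hp hp2.
set M := \sum_i `|eta i|.
have M0 : 0 < M.
  by rewrite /M (bigD1 i0) //= ltr_wpDr ?normr_gt0 // sumr_ge0.
have form1 := tree_form_le x_inj eta0 K0 wVK; rewrite -/M in form1.
have diff : \sum_i \sum_j (tree_dist (x i) (x j) `^ p) * eta i * eta j
    <= \sum_i \sum_j tree_dist (x i) (x j) * eta i * eta j
       + M ^+ 2 * (4 * K)^-1.
  rewrite -lerBlDl -sumrB /M expr2 mulrAC mulr_suml mulr_suml.
  apply: ler_sum => i _; rewrite -sumrB mulr_sumr; apply: ler_sum => j _.
  rewrite -!mulrBl; apply: le_trans (ler_norm _) _; rewrite !normrM.
  rewrite ler_wpM2r // mulrC ler_wpM2l //.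
  exact: le_trans (tree_dist_powR_near1 _ _ wK wVK p0 hp) hp2.
apply: le_lt_trans diff _.
have gap : M ^+ 2 / (2 * K) = 2 * (M ^+ 2 / (4 * K)) by field; rewrite gt_eqF.
have : 0 < M ^+ 2 / (4 * K) by rewrite divr_gt0 ?exprn_gt0 ?mulr_gt0.
lra.
Qed.

End Perturbation.

Theorem theorem5p4 (R : realType) (ws : seq R) :
  exists zeta : R, 0 < zeta /\
    forall T : metric_tree R, (3 <= #|T|)%N -> perm_eq (edge_weights T) ws ->
    forall p : R, p \in `]1 - zeta, 1 + zeta[ ->
      strict_negative_type (@tree_dist R T) p.
Proof.
(* Edge weights are positive; the absolute values make zeta positive for every
   list of reals. *)
pose K : R := 1 + \sum_(w <- ws) (`|w| + `|w|^-1).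
have K1 : 1 <= K.
  by rewrite lerDl sumr_ge0 // => w _; rewrite addr_ge0 ?invr_ge0.
have K0 : 0 < K by apply: lt_le_trans K1.
(* This zeta solves [2 * K ^+ 2 * zeta = (4 * K)^-1], the condition that the
   perturbation stays below half of the gap. *)
exists (8 * K ^+ 3)^-1; split; first by rewrite invr_gt0 mulr_gt0 ?exprn_gt0.
move=> T _ pws p; rewrite in_itv /= => /andP[p1 p2].
have sumE (f : R -> R) : \sum_(w <- ws) f w = \sum_(A in edges T) f (weight A).
  by rewrite -(perm_big _ pws) /edge_weights big_map big_enum.
have KE : K = 1 + \sum_(A in edges T) weight A
                + \sum_(A in edges T) (weight A)^-1.
  rewrite /K sumE -addrA -big_split /=; congr (_ + _).
  by apply: eq_bigr => A /edge_weight_gt0 w0; rewrite gtr0_norm.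
have w0 : 0 <= \sum_(A in edges T) weight A.
  by apply: sumr_ge0 => A /edge_weight_gt0/ltW.
have wV0 : 0 <= \sum_(A in edges T) (weight A)^-1.
  by apply: sumr_ge0 => A /edge_weight_gt0/ltW; rewrite invr_ge0.
have wK : \sum_(A in edges T) weight A <= K by rewrite KE; lra.
have wVK : \sum_(A in edges T) (weight A)^-1 <= K by rewrite KE; lra.
have hp : `|p - 1| <= (8 * K ^+ 3)^-1 by rewrite ler_norml; lra.
have K2 : 1 <= K ^+ 2 by rewrite exprn_ege1.
have K3 : 1 <= K ^+ 3 by rewrite exprn_ege1.
have hp1 : K * `|p - 1| <= 2^-1.
  apply: le_trans (ler_wpM2l (ltW K0) hp) _.
  have -> : K * (8 * K ^+ 3)^-1 = 8^-1 * (K ^+ 2)^-1.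
    by field; rewrite gt_eqF.
  have : (K ^+ 2)^-1 <= 1 by rewrite invf_le1 ?exprn_gt0.
  lra.
have hp2 : 2 * K ^+ 2 * `|p - 1| <= (4 * K)^-1.
  have -> : (4 * K)^-1 = 2 * K ^+ 2 * (8 * K ^+ 3)^-1 by field; rewrite gt_eqF.
  by rewrite ler_wpM2l // mulr_ge0 ?exprn_ge0 ?ltW.
have p0 : 0 < p.
  have : (8 * K ^+ 3)^-1 <= 1 by rewrite invf_le1 ?mulr_gt0 ?exprn_gt0 //; lra.
  lra.
have strict n (x : 'I_n -> T) (eta : 'I_n -> R) :
    injective x -> \sum_(i < n) eta i = 0 -> (exists i, eta i != 0) ->
    negative_type_sum (@tree_dist R T) p x eta < 0.
  by move=> *; apply: (@tree_form_powR_lt0 R T _ x eta K p).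
split; last by move=> n x eta _; apply: strict.
split=> [|n x eta _ x_inj eta0]; first exact: ltW.
case: (pickP (fun i => eta i != 0)) => [i ni | z].
  by apply/ltW/strict => //; exists i.
rewrite /negative_type_sum big1 // => i _; rewrite big1 // => j _.
by rewrite (eqP (negbFE (z i))) mulr0 mul0r.
Qed.
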